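(* Fix $\alpha \in (0,1)\setminus \mathbf{Q}$ and let $(G(T))_{T\in\mathbf{N}}$ and $G(\infty)$ be generated by the evolving Shelah–Spencer process with parameter $\alpha$. For each integer $r \geq 1$, with probability $1$ there exists a constant $C_r>0$ such that for all $T \leq \infty$ (i.e. for every $T\in\mathbf{N}$ and for $T=\infty$) there are at most $C_r$ many $r$-irregular vertices in $G(T)$.
   Context: Evolving Shelah–Spencer process with parameter $\alpha>0$: start with a graph $G(1)$ consisting of a single node $u_1$. At each time $\tau \geq 2$, form $G(\tau)$ by adding a new node $u_\tau$ to $G(\tau-1)$ and joining $u_\tau$ to each earlier node $u_j$ ($j<\tau$) independently with probability $\tau^{-\alpha}$. $G(\infty)=\bigcup_\tau G(\tau)$ is the infinite limit graph. For finite graphs $A,B$ (either disjoint abstract graphs, or subgraphs of a common graph with $AB$ the induced subgraph on the union of their vertex sets), $\mathcal{V}(B/A)$ is the number of vertices of $AB$ not in $A$, $\mathcal{E}(B/A)$ the number of edges of $AB$ not having both endpoints in $A$, and $\delta_\alpha(B/A)=\mathcal{V}(B/A)-\alpha\,\mathcal{E}(B/A)$; write $\delta_\alpha(B)=\delta_\alpha(B/\emptyset)$. The extension $B/A$ is rigid if $\delta_\alpha(B/I)\le 0$ for all $I$ with $A\subseteq I \subsetneq AB$. A finite graph $H$ is rigid if $H/\emptyset$ is rigid. For $r\ge 1$, a vertex is $r$-irregular if it is contained in a rigid subgraph (of the ambient graph) with at most $r$ vertices. *)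

(* Defs.v *)
From HB Require Import structures.
From mathcomp Require Import all_boot all_order all_algebra finmap.
From mathcomp Require Import all_classical all_reals all_analysis.

Set Implicit Arguments.
Unset Strict Implicit.
Unset Printing Implicit Defensive.

Import Order.TTheory GRing.Theory Num.Theory.

Local Open Scope classical_set_scope.
Local Open Scope ring_scope.

(* Simple graphs, finite or infinite, whose nodes are natural numbers: the node
   u_tau of the evolving process is the number tau. *)
Record graph := Graph {
  vertices : set nat;
  edge : nat -> nat -> Prop;
  edge_sym : forall x y, edge x y -> edge y x;
  edge_irrefl : forall x, ~ edge x x;
  edge_vertex : forall x y, edge x y -> vertices x
}.

Definition finite_graph (G : graph) : Prop := finite_set (vertices G).

(* Subgraphs need not be induced. *)
Definition subgraph (H G : graph) : Prop :=
  vertices H `<=` vertices G /\ forall x y, edge H x y -> edge G x y.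

Definition proper_subgraph (H G : graph) : Prop :=
  subgraph H G /\ ~ subgraph G H.

Definition empty_graph : graph.
Proof. by apply: (@Graph set0 (fun _ _ => False)) => [x y []|x []|x y []]. Defined.

Definition induced (G : graph) (W : set nat) : graph.
Proof.
apply: (@Graph (vertices G `&` W) (fun x y => [/\ edge G x y, W x & W y])).
- by move=> x y [/edge_sym].
- by move=> x [/edge_irrefl].
- by move=> x y [/edge_vertex].
Defined.

(* The graph AB, for subgraphs A and B of the common graph G. *)
Definition joint (G A B : graph) : graph :=
  induced G (vertices A `|` vertices B).

(* V(B/A): the number of vertices of AB that are not in A. *)
Definition ext_nvert (G B A : graph) : nat :=
  #|` fset_set (vertices (joint G A B) `\` vertices A) |%fset.

(* E(B/A): each edge {x, y} is counted once, as the pair (x, y) with x < y. *)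
Definition ext_nedge (G B A : graph) : nat :=
  #|` fset_set [set p : nat * nat | [/\ (p.1 < p.2)%N,
        edge (joint G A B) p.1 p.2 &
        ~ (vertices A p.1 /\ vertices A p.2)]] |%fset.

(* delta_alpha(B/A), for finite subgraphs A and B of G. *)
Definition delta (R : realType) (alpha : R) (G B A : graph) : R :=
  (ext_nvert G B A)%:R - alpha * (ext_nedge G B A)%:R.

Definition rigid_ext (R : realType) (alpha : R) (G B A : graph) : Prop :=
  forall I : graph, subgraph A I -> proper_subgraph I (joint G A B) ->
    delta alpha G B I <= 0.

(* Rigidity of H is intrinsic to H: the common graph is H itself. *)
Definition rigid (R : realType) (alpha : R) (H : graph) : Prop :=
  finite_graph H /\ rigid_ext alpha H H empty_graph.

Definition irregular (R : realType) (alpha : R) (r : nat) (G : graph) :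
    set nat :=
  [set v | exists H : graph, [/\ subgraph H G, rigid alpha H,
     (#|` fset_set (vertices H) |%fset <= r)%N & vertices H v]].

(* G together with the node u, joined to the nodes of G that lie in N.  The
   clause x <> u only matters in the degenerate case where u is a node of G. *)
Definition add_node (G : graph) (u : nat) (N : set nat) : graph.
Proof.
apply: (@Graph (vertices G `|` [set u])
  (fun x y => [\/ edge G x y,
                  [/\ y = u, x <> u, vertices G x & N x] |
                  [/\ x = u, y <> u, vertices G y & N y]])).
- move=> x y [/edge_sym ?|?|?]; [exact: Or31|exact: Or33|exact: Or32].
- by move=> x [/edge_irrefl|[]|[]].
- by move=> x y [/edge_vertex|[]|[]]; [left|left|right].
Defined.

(* The set [joins tau] consists of the earlier nodes to which the node tau is
   joined.  Time starts at 1, the value at 0 being the empty graph. *)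
Fixpoint evolving_graph (joins : nat -> set nat) (T : nat) : graph :=
  if T is T'.+1 then add_node (evolving_graph joins T') T (joins T)
  else empty_graph.

Definition union_graph (F : nat -> graph) : graph.
Proof.
apply: (@Graph (\bigcup_(T in [set T | (1 <= T)%N]) vertices (F T))
  (fun x y => exists T, (1 <= T)%N /\ edge (F T) x y)).
- by move=> x y [T [T1 /edge_sym ?]]; exists T.
- by move=> x [T [_ /edge_irrefl]].
- by move=> x y [T [T1 /edge_vertex ?]]; exists T.
Defined.

Definition limit_graph (joins : nat -> set nat) : graph :=
  union_graph (evolving_graph joins).

(* Mutual independence of the events A i, for i in D. *)
Definition independent_events (d : measure_display) (Omega : measurableType d)
    (R : realType) (P : probability Omega R) (I : choiceType) (D : set I)
    (A : I -> set Omega) : Prop :=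
  forall J : {fset I}, [set` J] `<=` D ->
    P (\bigcap_(i in [set` J]) A i) = (\prod_(i <- J) P (A i))%E.

(* E (tau, j) is the event that the node tau is joined to the earlier node j
   when it is added. *)
Definition evolving_ShelahSpencer (d : measure_display)
    (Omega : measurableType d) (R : realType) (P : probability Omega R)
    (alpha : R) (E : nat * nat -> set Omega) : Prop :=
  let D := [set p : nat * nat | (1 <= p.2 < p.1)%N] in
  [/\ forall p, D p -> measurable (E p),
      forall p, D p -> P (E p) = (p.1%:R `^ (- alpha))%:E
    & independent_events P D E].

(* The realisations of the process at the outcome w: G(T) for T finite, and
   G(oo). *)
Definition ESS_graph (Omega : Type) (E : nat * nat -> set Omega) (T : nat)
    (w : Omega) : graph :=
  evolving_graph (fun tau => [set j | E (tau, j) w]) T.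

Definition ESS_limit (Omega : Type) (E : nat * nat -> set Omega) (w : Omega) :
    graph :=
  limit_graph (fun tau => [set j | E (tau, j) w]).

(* Main.v *)
(** Order the vertices of a rigid graph [H] by their time of birth.  Rigidity
    at the subgraph induced on the vertices up to [t] says that the [s] vertices
    of [H] above [t] and the [e] edges whose later endpoint is above [t] satisfy
    [s <= alpha e].  Since [alpha] is irrational and [H] has at most [r]
    vertices, this improves to [(1 + eta) s <= alpha e] with [eta > 0] depending
    on [alpha] and [r] only.  Summing over [t] against the increments of the
    logarithm bounds the probability of [H], which is the product of
    [y ^ (- alpha)] over the edges with later endpoint [y], by the product of
    [v ^ (- (1 + eta))] over the vertices [v].  Hence the copies of rigid graphs
    with latest vertex [n] have total probability [O(n ^ (- (1 + eta)))], and by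
    Borel-Cantelli only finitely many of them occur in the limit graph. *)
Require Import Defs.
From mathcomp Require Import all_boot all_order all_algebra finmap.
From mathcomp Require Import all_classical all_reals all_analysis.
From mathcomp Require Import ring.

Set Implicit Arguments.
Unset Strict Implicit.
Unset Printing Implicit Defensive.

Import Order.TTheory GRing.Theory Num.Theory.
Local Open Scope classical_set_scope.
Local Open Scope ring_scope.

(** * Numerical estimates *)

(** Equality [a = alpha b] with [a > 0] would make [alpha] rational, so each of the finitely many
    nontrivial inequalities is strict and a common relative margin exists. *)
Lemma irrational_gap (R : realType) (alpha : R) (N : nat) :
  irrational alpha ->
  exists2 eta : R, 0 < eta & forall a b : nat, (a <= N)%N -> (b <= N)%N ->
    a%:R <= alpha * b%:R -> (1 + eta) * a%:R <= alpha * b%:R.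
Proof.
move=> irr.
(* The relative margin of the pair; the default 1 keeps the minimum positive. *)
pose f (p : 'I_N.+1 * 'I_N.+1) : R :=
  if (0 < p.1)%N && (p.1%:R <= alpha * p.2%:R)
  then alpha * p.2%:R / p.1%:R - 1 else 1.
exists (\big[Num.min/1]_p f p).
  apply: lt_bigmin => // -[a b] _; rewrite /f /=.
  case: ifPn => // /andP[a_gt0 le_ab].
  have a_gt0' : 0 < (a : nat)%:R :> R by rewrite ltr0n.
  rewrite subr_gt0 ltr_pdivlMr// mul1r lt_neqAle le_ab andbT.
  apply/eqP => ab; apply: irr; apply/rationalP.
  exists (nat_of_ord a)%:Z, (nat_of_ord b); rewrite -pmulrn ab mulfK// pnatr_eq0.
  apply: contraTneq a_gt0' => b0.
  by rewrite ab b0 mulr0 ltxx.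
move=> a b aN bN le_ab.
have [->|a_gt0] := posnP a; first by rewrite mulr0 (le_trans _ le_ab).
have := bigmin_le 1 (@Ordinal N.+1 a aN, @Ordinal N.+1 b bN) f.
rewrite {2}/f /= a_gt0 le_ab /= => eta_le.
have a_gt0' : 0 < a%:R :> R by rewrite ltr0n.
by rewrite -ler_pdivlMr// -lerBrDl.
Qed.

(* Layer-cake summation: [phi m] is the sum of the increments of [phi] at the
   [t < m], so that only the numbers of points above each level matter. *)
Lemma ler_sum_card_above (R : realType) (phi : nat -> R) (I J : finType)
    (A : {set I}) (B : {set J}) (u : I -> nat) (v : J -> nat)
    (N : nat) (a b : R) :
  phi 0%N = 0 -> nondecreasing_seq phi ->
  (forall i, u i <= N)%N -> (forall j, v j <= N)%N ->
  (forall t, (t < N)%N ->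
     a * #|[set i in A | (t < u i)%N]%SET|%:R <=
     b * #|[set j in B | (t < v j)%N]%SET|%:R) ->
  a * \sum_(i in A) phi (u i) <= b * \sum_(j in B) phi (v j).
Proof.
move=> phi0 phi_nd uN vN ab.
have layer (m : nat) : (m <= N)%N ->
    phi m = \sum_(t < N) (phi t.+1 - phi t) * (t < m)%N%:R.
  move=> mN; rewrite -[LHS]subr0 -{1}phi0 -(telescope_sumr phi (leq0n m)).
  rewrite big_mkord (big_ord_widen N (fun t => phi t.+1 - phi t)) ?big_mkcond//=.
  by apply: eq_bigr => t _; case: ifP; rewrite ?mulr1 ?mulr0.
have sum_layer (K : finType) (C : {set K}) (w : K -> nat) :
    (forall k, w k <= N)%N ->
    \sum_(k in C) phi (w k) = \sum_(t < N)
      (phi t.+1 - phi t) * #|[set k in C | (t < w k)%N]%SET|%:R.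
  move=> wN; under eq_bigr do rewrite layer//.
  rewrite exchange_big /=; apply: eq_bigr => t _.
  rewrite -mulr_sumr -sum1_card natr_sum big_mkcond [in RHS]big_mkcond /=.
  congr (_ * _); apply: eq_bigr => k _.
  by rewrite inE; case: (k \in C); case: (t < w k)%N.
rewrite !sum_layer// !mulr_sumr; apply: ler_sum => t _.
by rewrite !(mulrCA _ (_ - _)) ler_wpM2l ?ab// subr_ge0 phi_nd.
Qed.

(** Comparison with the integral: each term after the first is at most an increment of
    [- x ^ (- eta) / eta], and these telescope. *)
Lemma powR_sum_le (R : realType) (eta : R) : 0 < eta ->
  exists K : R, forall N : nat,
    \sum_(1 <= n < N) n%:R `^ (- (1 + eta)) <= K.
Proof.
move=> eta0; exists (1 + eta^-1).
have step (n : nat) : n.+2%:R `^ (- (1 + eta)) <=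
    eta^-1 * (- n.+2%:R `^ (- eta) + n.+1%:R `^ (- eta)) :> R.
  have n1 : 0 < n.+1%:R :> R by rewrite ltr0n.
  have n2 : 0 < n.+2%:R :> R by rewrite ltr0n.
  rewrite /powR !pnatr_eq0 /=.
  set x := ln n.+1%:R; set y := ln n.+2%:R.
  (* This is [ln (1 + z) <= z] at [z = - 1 / (n + 2)]. *)
  have yx : n.+2%:R^-1 <= y - x.
    have : x - y <= - n.+2%:R^-1.
      rewrite -ln_div ?posrE//.
      have -> : n.+1%:R / n.+2%:R = 1 + (- n.+2%:R^-1) :> R.
        by rewrite -[n.+1%:R](addrK 1) natr1 mulrBl mulfV ?gt_eqF// mul1r.
      apply: le_ln1Dx; rewrite ltrN2 invf_lt1// ltr1n//.
    by rewrite lerNr opprB.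
  have -> : expR (- (1 + eta) * y) = n.+2%:R^-1 * expR (- eta * y).
    rewrite opprD mulrDl mulN1r expRD; congr (_ * _).
    by rewrite expRN lnK// posrE.
  have -> : expR (- eta * x) = expR (- eta * y) * expR (eta * (y - x)).
    by rewrite -expRD; congr expR; rewrite mulrBr !mulNr addrA addNr sub0r.
  set e := expR (- eta * y).
  have e0 : 0 < e by exact: expR_gt0.
  have -> : eta^-1 * (- e + e * expR (eta * (y - x))) =
      (expR (eta * (y - x)) - 1) / eta * e by field; rewrite gt_eqF.
  rewrite ler_pM2r//. rewrite ler_pdivlMr// lerBrDl mulrC.
  by rewrite (le_trans _ (expR_ge1Dx _))// lerD2l ler_pM2l.
case=> [|[|N]]; try by rewrite big_geq// addr_ge0// invr_ge0 ltW.
rewrite big_nat_recl// powR1 lerD2l.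
have -> : eta^-1 = eta^-1 * (- 0 + 1%:R `^ (- eta)).
  by rewrite powR1 oppr0 add0r mulr1.
apply: (@le_trans _ _ (eta^-1 * (- N.+1%:R `^ (- eta) + 1%:R `^ (- eta)))); last first.
  by rewrite ler_pM2l ?invr_gt0// lerD2r lerN2 powR_ge0.
have := telescope_sumr (fun n => - n%:R `^ (- eta) : R) (ltn0Sn N).
rewrite opprK => <-; rewrite mulr_sumr.
apply: ler_sum_nat => -[//|n] _.
by rewrite opprK.
Qed.

(** The sum expands a product with factor [f i + 1] for [i < n] and [f n] alone at the top, which
    forces [ord_max] into [S]; then [1 + x <= expR x]. *)
Lemma sum_prod_set_max_le (R : realType) (f : nat -> R) (n : nat) :
  (forall i, 0 <= f i) ->
  \sum_(S : {set 'I_n.+1} | ord_max \in S) \prod_(i in S) f i <=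
    f n * expR (\sum_(i < n) f i).
Proof.
move=> f0.
have -> : \sum_(S : {set 'I_n.+1} | ord_max \in S) \prod_(i in S) f i =
    \prod_(i < n.+1) (f i + (i != ord_max)%:R).
  rewrite bigA_distr big_mkcond /=; apply: eq_bigr => S _; case: ifPn => maxS.
    rewrite big_mkcond; apply: eq_bigr => i _; case: ifPn => // iS.
    by rewrite (_ : i != ord_max)//; apply: contraNneq iS => ->.
  by rewrite (bigD1 ord_max)//= (negbTE maxS) eqxx mul0r.
rewrite big_ord_recr /= eqxx addr0 mulrC ler_wpM2l// expR_sum.
apply: ler_prod => i _; rewrite addr_ge0//= addrC.
rewrite (le_trans _ (expR_ge1Dx _))// lerD2r.
by case: (_ != _).
Qed.

(** * Patterns and their probability *)

(** The trace of a rigid graph with latest vertex [n], coded in finite types for the union bound.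
    Edges carry the later endpoint first, as in [E]. Levels [t >= n] would be vacuous, both counts
    being zero. *)
Definition rigid_pattern (R : realType) (alpha eta : R) (r n : nat)
    (S : {set 'I_n.+1}) (e : {set 'I_n.+1 * 'I_n.+1}) : Prop :=
  [/\ ord_max \in S, (#|S| <= r)%N, forall v, v \in S -> (0 < v)%N,
      forall p, p \in e -> [/\ p.1 \in S, p.2 \in S & (p.2 < p.1)%N]
    & forall t : nat, (t < n)%N ->
        (1 + eta) * #|[set v in S | (t < v)%N]%SET|%:R <=
        alpha * #|[set p in e | (t < p.1)%N]%SET|%:R].

(** After taking logarithms, this is the layer-cake inequality for [phi = ln]. *)
Lemma rigid_pattern_weight_le (R : realType) (alpha eta : R) (r n : nat)
    (S : {set 'I_n.+1}) (e : {set 'I_n.+1 * 'I_n.+1}) :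
  rigid_pattern alpha eta r S e ->
  \prod_(p in e) p.1%:R `^ (- alpha) <= \prod_(v in S) v%:R `^ (- (1 + eta)).
Proof.
move=> [_ _ Spos eS dens].
have powRN_expR (m : nat) (x : R) : (0 < m)%N ->
    m%:R `^ (- x) = expR (- (x * ln m%:R)).
  by move=> m0; rewrite /powR pnatr_eq0 eqn0Ngt m0 /= mulNr.
rewrite (eq_bigr (fun p : 'I_n.+1 * 'I_n.+1 =>
  expR (- (alpha * ln (p.1 : nat)%:R)))); last first.
  by move=> p pe; apply: powRN_expR; apply: Spos; have [] := eS _ pe.
rewrite [leRHS](eq_bigr (fun v : 'I_n.+1 =>
  expR (- ((1 + eta) * ln (v : nat)%:R)))); last first.
  by move=> v vS; apply: powRN_expR; apply: Spos.
rewrite -!expR_sum ler_expR !sumrN lerN2 -!mulr_sumr.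
apply: (@ler_sum_card_above R (fun m : nat => ln m%:R) _ _ S e
  (fun v => v : nat) (fun p => p.1 : nat) n) => //.
(* The convention [ln 0 = 0] gives [phi 0 = 0] and, as [ln 1 = 0], keeps [phi] monotone at 0. *)
- by rewrite ln0.
- move=> m p mp; case: m mp => [_|m mp]; last first.
    by rewrite ler_ln ?ler_nat// posrE ltr0n// (leq_trans _ mp).
  rewrite ln0//; case: p => [|p]; first by rewrite ln0.
  by rewrite ln_ge0// ler1n.
- by move=> i; rewrite -ltnS.
- by move=> j; rewrite -ltnS.
Qed.

Definition edge_event (Omega : Type) (E : nat * nat -> set Omega) (n : nat)
    (e : {set 'I_n * 'I_n}) : set Omega :=
  \bigcap_(p in [set` e]) E (nat_of_ord p.1, nat_of_ord p.2).

(* [n] is the latest vertex of the pattern: this makes the union finite and gives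
   the sequence of events for Borel-Cantelli. *)
Definition pattern_event (Omega : Type) (E : nat * nat -> set Omega)
    (R : realType) (alpha eta : R) (r n : nat) : set Omega :=
  \big[setU/set0]_(q : {set 'I_n.+1} * {set 'I_n.+1 * 'I_n.+1} |
      `[< rigid_pattern alpha eta r q.1 q.2 >]) edge_event E q.2.

Lemma probability_edge_event (R : realType) (alpha : R)
    (d : measure_display) (Omega : measurableType d) (P : probability Omega R)
    (E : nat * nat -> set Omega) (n : nat) (e : {set 'I_n * 'I_n}) :
  evolving_ShelahSpencer P alpha E ->
  (forall p, p \in e -> (1 <= p.2 < p.1)%N) ->
  measurable (edge_event E e) /\
  P (edge_event E e) = (\prod_(p in e) p.1%:R `^ (- alpha))%:E.
Proof.
move=> [mE PE indE] eD.
split.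
  apply: fin_bigcap_measurable; first exact: finite_finset.
  by move=> p /= pe; apply: mE; exact: eD.
(* Independence is stated for pairs of naturals, so the index set is transported along an
   injection. *)
pose f (p : 'I_n * 'I_n) := (nat_of_ord p.1, nat_of_ord p.2).
have f_inj : injective f.
  by move=> [a b] [a' b'] [] /val_inj -> /val_inj ->.
pose J : {fset nat * nat} := [fset f p | p in e]%fset.
have -> : edge_event E e = \bigcap_(i in [set` J]) E i.
  apply/seteqP; split => w /= Ew.
    by move=> i /= /imfsetP[p /= pe ->]; exact: Ew.
  by move=> p /= pe; apply: (Ew (f p)); apply/imfsetP; exists p.
rewrite indE; last by move=> i /= /imfsetP[p /= pe ->]; exact: eD.
rewrite big_imfset /=; last by move=> p q _ _; exact: f_inj.
rewrite big_enum /= -prodEFin.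
by apply: eq_bigr => p pe; apply: PE; exact: eD.
Qed.

(** Union bound: the weight of a pattern is bounded in terms of [S] alone, and each [S] of size at
    most [r] carries at most [2 ^ (r * r)] edge sets. *)
Lemma probability_pattern_event_le (R : realType) (alpha eta : R)
    (d : measure_display) (Omega : measurableType d) (P : probability Omega R)
    (E : nat * nat -> set Omega) (r n : nat) :
  evolving_ShelahSpencer P alpha E ->
  let f := fun m : nat => m%:R `^ (- (1 + eta)) in
  measurable (pattern_event E alpha eta r n) /\
  (P (pattern_event E alpha eta r n) <=
    ((2 ^ (r * r))%:R * (f n * expR (\sum_(i < n) f i)))%:E)%E.
Proof.
move=> hE f.
have f_ge0 m : 0 <= f m by exact: powR_ge0.
pose good (q : {set 'I_n.+1} * {set 'I_n.+1 * 'I_n.+1}) :=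
  `[< rigid_pattern alpha eta r q.1 q.2 >].
have [mF PF] : measurable (pattern_event E alpha eta r n) /\
    (P (pattern_event E alpha eta r n) <=
       (\sum_(q | good q) \prod_(v in q.1) f v)%:E)%E.
  rewrite /pattern_event -/good.
  elim/big_rec2 : _ => [|q x A /asboolP gq [mA PA]]; first by rewrite measure0.
  have [|mq Pq] := probability_edge_event (e := q.2) hE.
    case: gq => _ _ Spos eS _ p /eS[_ p2S ->].
    by rewrite (Spos _ p2S).
  split; first exact: measurableU.
  apply: (@le_trans _ _ (P (edge_event E q.2) + P A)%E); first exact: measureU2.
  rewrite EFinD leeD//.
  by rewrite Pq lee_fin; apply: rigid_pattern_weight_le gq.
split=> //; apply: (le_trans PF); rewrite lee_fin.
(* Of the pattern conditions only [ord_max \in S], [#|S| <= r] and the inclusion of [e] in [S * S]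
   are kept. *)
apply: (@le_trans _ _ (\sum_(S : {set 'I_n.+1} | ord_max \in S)
    \sum_(e in finset.powerset (finset.setX S S) | (#|S| <= r)%N) \prod_(v in S) f v)).
  rewrite pair_big_dep /= big_mkcond [leRHS]big_mkcond /=.
  apply: ler_sum => -[S e] _ /=.
  have pf : 0 <= \prod_(v in S) f v by exact: prodr_ge0.
  case: ifPn => [/asboolP[/= -> -> _ eS _]|_]; last by case: ifP.
  rewrite (_ : e \in _)//= powersetE; apply/fintype.subsetP => p /eS[p1 p2 _].
  by rewrite inE p1.
apply: (@le_trans _ _ ((2 ^ (r * r))%:R *
    \sum_(S : {set 'I_n.+1} | ord_max \in S) \prod_(v in S) f v)); last first.
  by rewrite ler_wpM2l// sum_prod_set_max_le.
rewrite mulr_sumr; apply: ler_sum => S _.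
have pf : 0 <= \prod_(v in S) f v by exact: prodr_ge0.
have [Sr|Sr] := leqP #|S| r; last first.
  by rewrite big1 ?mulr_ge0// => e; rewrite andbF.
rewrite (eq_bigl (mem (finset.powerset (finset.setX S S)))); last first.
  by move=> e; rewrite /= andbT.
rewrite sumr_const; rewrite card_powerset cardsX -[leLHS]mulr_natl ler_wpM2r//.
by rewrite ler_nat leq_pexp2l// leq_mul.
Qed.

(** * Counting and the structure of the evolving graph *)

Lemma card_fset_set_image (K : choiceType) (I : finType) (f : I -> K)
    (X : {set I}) (A : set K) :
  injective f -> A = f @` [set` X] -> #|` fset_set A |%fset = #|X|.
Proof.
move=> f_inj AE.
have Afin : finite_set A by rewrite AE; apply: finite_image; exact: finite_finset.
have -> : fset_set A = [fset f x | x in X]%fset.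
  apply/fsetP => k; rewrite in_fset_set//; apply/idP/imfsetP => /=.
    by rewrite inE AE => -[x /= xX <-]; exists x.
  by move=> [x xX ->]; rewrite inE AE; exists x.
by rewrite card_imfset//= cardE.
Qed.

Lemma evolving_graph_vertices (joins : nat -> set nat) (T v : nat) :
  vertices (evolving_graph joins T) v <-> (1 <= v <= T)%N.
Proof.
elim: T => [|T IH] /=; first by split=> //; case: v.
split=> [[/IH/andP[-> vT]|->]|/andP[v1]]; first exact: leqW.
  by rewrite leqnn.
rewrite leq_eqVlt ltnS => /orP[/eqP ->|vT]; first by right.
by left; apply/IH; rewrite v1.
Qed.

Lemma evolving_graph_edge (joins : nat -> set nat) (T x y : nat) :
  (x < y)%N -> edge (evolving_graph joins T) x y -> (1 <= x)%N /\ joins y x.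
Proof.
move=> xy; elim: T => [|T IH] //=.
case=> [/IH //|[-> _ /evolving_graph_vertices/andP[]//]|].
move=> [xT _ /evolving_graph_vertices/andP[_ yT] _].
by move: xy; rewrite xT ltnNge (leqW yT).
Qed.

Lemma subgraph_trans (G1 G2 G3 : graph) :
  subgraph G1 G2 -> subgraph G2 G3 -> subgraph G1 G3.
Proof.
move=> [v12 e12] [v23 e23]; split; first exact: subset_trans v12 v23.
by move=> x y /e12/e23.
Qed.

Lemma subgraph_union_graph (F : nat -> graph) (T : nat) :
  (1 <= T)%N -> subgraph (F T) (union_graph F).
Proof. by move=> T1; split=> [v vT|x y xyT]; exists T. Qed.

(** Rigidity is intrinsic to [H], so the same witness serves in [G']. This reduces all finite times
    to the limit graph. *)
Lemma irregular_subgraph (R : realType) (alpha : R) (r : nat) (G G' : graph) :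
  subgraph G G' -> irregular alpha r G `<=` irregular alpha r G'.
Proof.
move=> GG' v [H [HG rH cH Hv]]; exists H; split=> //.
exact: subgraph_trans HG GG'.
Qed.

Lemma edge_vertex_r (G : graph) (x y : nat) : edge G x y -> vertices G y.
Proof. by move/edge_sym/edge_vertex. Qed.

(** * From rigid subgraphs to patterns *)

Section rigid_subgraph.
Variables (R : realType) (alpha : R) (H : graph) (n : nat).
Hypotheses (Hrigid : rigid alpha H) (Hn : vertices H n)
  (Hmax : forall v, vertices H v -> (v <= n)%N).

Let S : {set 'I_n.+1} :=
  [set v : 'I_n.+1 | `[< vertices H v >]]%SET.
Let e : {set 'I_n.+1 * 'I_n.+1} :=
  [set p : 'I_n.+1 * 'I_n.+1 | (p.2 < p.1)%N && `[< edge H p.2 p.1 >]]%SET.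

Let vertex_ord v : vertices H v -> exists i : 'I_n.+1, v = i.
Proof. by move=> /Hmax; rewrite -ltnS => vn; exists (Ordinal vn). Qed.

Let lower (t : nat) : graph := Defs.induced H [set v | (v <= t)%N].

Let ext_nvert_lower t :
  ext_nvert H H (lower t) = #|[set v in S | (t < v)%N]%SET|.
Proof.
apply: (card_fset_set_image val_inj); apply/seteqP; split=> v /=.
  move=> [[Hv _]] vt; have [i vi] := vertex_ord Hv; exists i => //=.
  rewrite !inE; apply/andP; split; first by apply/asboolP; rewrite -vi.
  by rewrite -vi ltnNge; apply/negP => ?; apply: vt.
move=> [i /=]; rewrite !inE => /andP[/asboolP Hi ti] <-.
by split; [split=> //; right|move=> [_]; rewrite leqNgt ti].
Qed.

(** An edge of [H] fails to lie within the vertices up to [t] exactly when its later endpoint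
    exceeds [t]. *)
Let ext_nedge_lower t :
  ext_nedge H H (lower t) = #|[set p in e | (t < p.1)%N]%SET|.
Proof.
(* The swap reconciles two conventions: [ext_nedge] puts the smaller endpoint first, patterns the
   later one. *)
pose f (p : 'I_n.+1 * 'I_n.+1) := (nat_of_ord p.2, nat_of_ord p.1).
apply: (@card_fset_set_image _ _ f).
  by move=> [a b] [a' b'] [] /val_inj -> /val_inj ->.
apply/seteqP; split=> -[x y] /=.
  move=> [xy [Hxy _ _] xyt].
  have [i xi] := vertex_ord (edge_vertex Hxy).
  have [j yj] := vertex_ord (edge_vertex_r Hxy).
  exists (j, i); last by rewrite /f /= -xi -yj.
  rewrite /= !inE /= -xi -yj xy /=; apply/andP; split; first exact/asboolP.
  rewrite ltnNge; apply/negP => yt; apply: xyt.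
  split; split=> //; first exact: edge_vertex Hxy.
    exact: leq_trans (ltnW xy) yt.
  exact: edge_vertex_r Hxy.
move=> [[j i] /=]; rewrite !inE /= => /andP[/andP[ij /asboolP Hij] tj] [<- <-].
split=> //; last by move=> [_ [_]]; rewrite leqNgt tj.
split=> //; right; first exact: edge_vertex Hij.
exact: edge_vertex_r Hij.
Qed.

(* The density of the part of [H] above the level [t] is read off rigidity at
   the subgraph of [H] induced on the vertices up to [t]. *)
Let rigid_above t : (t < n)%N ->
  #|[set v in S | (t < v)%N]%SET|%:R <=
  alpha * #|[set p in e | (t < p.1)%N]%SET|%:R :> R.
Proof.
move=> tn; have [_ /(_ (lower t))] := Hrigid.
rewrite /delta ext_nvert_lower ext_nedge_lower subr_le0; apply.
  by split.
split; first split.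
- by move=> v [Hv _]; split=> //; right.
- move=> x y [Hxy _ _]; split=> //; right; first exact: edge_vertex Hxy.
  exact: edge_vertex_r Hxy.
(* The vertex [n] is missing from [lower t], which is therefore proper. *)
- move=> [+ _] => /(_ n) [|_ /=]; first by split=> //; right.
  by rewrite leqNgt tn.
Qed.

(** At every level at most [r] vertices and [r * r] edges are counted, so the gap hypothesis
    sharpens [rigid_above]. *)
Lemma rigid_subgraph_pattern (G : graph) (eta : R) (r : nat) :
  subgraph H G -> (#|` fset_set (vertices H) |%fset <= r)%N ->
  (forall v, vertices G v -> (0 < v)%N) ->
  (forall a b : nat, (a <= r * r)%N -> (b <= r * r)%N ->
    a%:R <= alpha * b%:R -> (1 + eta) * a%:R <= alpha * b%:R) ->
  exists (S' : {set 'I_n.+1}) (e' : {set 'I_n.+1 * 'I_n.+1}),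
    rigid_pattern alpha eta r S' e' /\
    forall p, p \in e' -> (p.2 < p.1)%N /\ edge G p.2 p.1.
Proof.
move=> [vHG eHG] Hr Gpos gap; exists S, e.
have Sr : (#|S| <= r)%N.
  rewrite -(@card_fset_set_image _ _ _ S (vertices H) (@ord_inj n.+1))//.
  apply/seteqP; split=> v /=.
    move=> Hv; have [i vi] := vertex_ord Hv; exists i => //=.
    by rewrite inE; apply/asboolP; rewrite -vi.
  by move=> [i /=]; rewrite inE => /asboolP Hi <-.
have eS p : p \in e -> [/\ p.1 \in S, p.2 \in S & (p.2 < p.1)%N].
  rewrite !inE => /andP[pp /asboolP Hp]; split=> //.
    exact: edge_vertex_r Hp.
  exact: edge_vertex Hp.
have er : (#|e| <= r * r)%N.
  apply: leq_trans (leq_mul Sr Sr); rewrite -cardsX.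
  by apply: subset_leq_card; apply/fintype.subsetP => p /eS[? ? _]; rewrite inE; apply/andP.
split; last first.
  move=> p; rewrite !inE => /andP[pp /asboolP /eHG]; split=> //.
split=> //.
- by rewrite inE; apply/asboolP.
- by move=> v; rewrite inE => /asboolP /vHG /Gpos.
- move=> t tn; apply: gap; last exact: rigid_above.
    apply: leq_trans (subset_leq_card _) (leq_trans Sr _).
      by apply/fintype.subsetP => v; rewrite inE => /andP[].
    by case: (r) => // m; rewrite leq_pmulr.
  apply: leq_trans (subset_leq_card _) er.
  by apply/fintype.subsetP => v; rewrite inE => /andP[].
Qed.

End rigid_subgraph.

(** Take [n] to be the latest vertex of a rigid witness, which is finite. The bound [v <= n] lets
    finitely many occurring patterns confine all irregular vertices. *)
Lemma irregular_ESS_limit_pattern (R : realType) (alpha eta : R) (r : nat)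
    (Omega : Type) (E : nat * nat -> set Omega) (w : Omega) (v : nat) :
  (forall a b : nat, (a <= r * r)%N -> (b <= r * r)%N ->
    a%:R <= alpha * b%:R -> (1 + eta) * a%:R <= alpha * b%:R) ->
  irregular alpha r (ESS_limit E w) v ->
  exists2 n, (v <= n)%N & pattern_event E alpha eta r n w.
Proof.
move=> gap [H [HG Hrigid Hr Hv]].
have [n [Hn Hmax]] :
    exists n, vertices H n /\ forall u, vertices H u -> (u <= n)%N.
  have Hfin : finite_set (vertices H) by case: Hrigid.
  have exH : exists u, `[< vertices H u >] by exists v; apply/asboolP.
  have [M HM] : exists M, forall u, `[< vertices H u >] -> (u <= M)%N.
    exists (\max_(u <- fset_set (vertices H)) u)%N => u /asboolP Hu.
    by apply: leq_bigmax_seq => //; rewrite in_fset_set// inE.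
  case: (ex_maxnP exH HM) => n /asboolP Hn nmax; exists n; split=> // u Hu.
  by apply: nmax; apply/asboolP.
exists n; first exact: Hmax.
have [|S [e [pat eG]]] := rigid_subgraph_pattern Hrigid Hn Hmax HG Hr _ gap.
  by move=> u [T _ /evolving_graph_vertices/andP[]].
rewrite /pattern_event -bigcup_seq_cond.
exists (S, e) => /=; first by rewrite mem_index_enum; apply/asboolP.
move=> p /= /eG [pp [T [_ /(evolving_graph_edge pp)[]]]].
by [].
Qed.

(** * Borel-Cantelli and the uniform bound *)

Theorem mainTheorem1 (R : realType) (alpha : R)
    (alpha_gt0 : 0 < alpha) (alpha_lt1 : alpha < 1)
    (alpha_irr : irrational alpha)
    (d : measure_display) (Omega : measurableType d) (P : probability Omega R)
    (E : nat * nat -> set Omega)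
    (hE : evolving_ShelahSpencer P alpha E)
    (r : nat) (r_ge1 : (1 <= r)%N) :
  {ae P, forall w : Omega, exists C : nat, (0 < C)%N /\
     (forall T : nat, (1 <= T)%N ->
        (irregular alpha r (ESS_graph E T w) #<= `I_C)%card) /\
     (irregular alpha r (ESS_limit E w) #<= `I_C)%card}.
Proof.
have [eta eta0 gap] := irrational_gap (r * r) alpha_irr.
pose F := pattern_event E alpha eta r.
have mF n : measurable (F n).
  by have [] := probability_pattern_event_le eta r n hE.
exists (lim_sup_set F); split.
- by apply: bigcap_measurable => // n _; apply: bigcup_measurable.
- apply: lim_sup_set_cvg0 => //.
  pose f (m : nat) : R := m%:R `^ (- (1 + eta)).
  have f_ge0 m : 0 <= f m by exact: powR_ge0.
  have [K hK] := powR_sum_le eta0.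
  have f_sum n : \sum_(i < n) f i <= K.
    case: n => [|n]; first by rewrite big_ord0; have := hK 0%N; rewrite big_geq.
    (* The term at 0 vanishes, since 0 to a nonzero power is 0. *)
    rewrite big_ord_recl /= {1}/f powR0 ?oppr_eq0 ?gt_eqF ?addr_gt0// add0r.
    have := hK n.+1; rewrite big_add1 /= big_mkord; exact: le_trans.
  pose c : R := (2 ^ (r * r))%:R * expR K.
  have c_ge0 : 0 <= c by rewrite mulr_ge0// expR_ge0.
  have PF n : (P (F n) <= (c * f n)%:E)%E.
    have [_ /le_trans] := probability_pattern_event_le eta r n hE; apply.
    rewrite lee_fin /c -mulrA ler_wpM2l// mulrC ler_wpM2r//.
    by rewrite ler_expR.
  apply: (@le_lt_trans _ _ (c * K)%:E); last exact: ltry.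
  apply: lime_le; first exact: is_cvg_nneseries.
  apply: nearW => n; apply: (@le_trans _ _ (\sum_(0 <= i < n) (c * f i)%:E)%E).
    by apply: lee_sum => i _; exact: PF.
  rewrite sumEFin lee_fin -mulr_sumr ler_wpM2l//.
  by rewrite big_mkord.
- move=> w; apply: contra_notP => /= Fw.
  have [N FN] : exists N, forall n, (N <= n)%N -> ~ F n w.
    apply: contrapT => noN; apply: Fw => n _.
    apply: contrapT => nF; apply: noN; exists n => m nm Fm.
    by apply: nF; exists m.
  (* An irregular [v] lies below some [n] whose pattern event occurs, hence [n < N]. The bound
     [N.+1] also makes the constant positive. *)
  have irrN : irregular alpha r (ESS_limit E w) `<=` `I_N.+1.
    move=> v /(irregular_ESS_limit_pattern gap)[n vn Fn] /=.
    rewrite ltnS; apply: (leq_trans vn); apply/ltnW; rewrite ltnNge.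
    by apply/negP => /FN.
  exists N.+1; split=> //; split=> [T T1|]; apply: subset_card_le => //.
  apply: subset_trans irrN; apply: irregular_subgraph.
  exact: subgraph_union_graph.
Qed.
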